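(* Let $L$ satisfy (1)–(3) of the context, fix $h>0$, and for each $\epsilon>0$ let $\phi_{\epsilon,h},\bar\phi_{\epsilon,h},\lambda_{\epsilon,h}$ be as in the context, normalized and uniformly bounded. Put $\overline H_{\epsilon,h}=\lambda_{\epsilon,h}/h$ and let $\mu_{\epsilon,h}$ be the probability measure on $\mathbb{T}^N\times\mathbb{R}^N$ with density $e^{-f_{\epsilon,h}(x,v)/\epsilon}$, where $$f_{\epsilon,h}(x,v)=\frac{\bar\phi_{\epsilon,h}(x)+\phi_{\epsilon,h}(x)}{h}+L(x,v)+\frac{\phi_{\epsilon,h}(x+hv)-\phi_{\epsilon,h}(x)}{h}-\overline H_{\epsilon,h}.$$ Suppose that the uniform limits of $\phi_{\epsilon,h}$ and $\bar\phi_{\epsilon,h}$ as $\epsilon\to0$ do not depend on the subsequence, so that $\phi_{\epsilon,h}\to\phi_h$ and $\bar\phi_{\epsilon,h}\to\bar\phi_h$ uniformly on $\mathbb{T}^N$ as $\epsilon\to 0$, and define $$I_h(x,v)=\frac{\bar\phi_h(x)+\phi_h(x+hv)}{h}+L(x,v)-\overline H_h .$$ Then for every closed bounded set $A\subset\mathbb{T}^N\times\mathbb{R}^N$, $$\limsup_{\epsilon\to0}\epsilon\ln\mu_{\epsilon,h}(A)\le-\inf_{(x,v)\in A}I_h(x,v),$$ and for every open bounded set $A\subset\mathbb{T}^N\times\mathbb{R}^N$, $$\liminf_{\epsilon\to0}\epsilon\ln\mu_{\epsilon,h}(A)\ge-\inf_{(x,v)\in A}I_h(x,v).$$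
   Context: $\mathbb{T}^N=\mathbb{R}^N/\mathbb{Z}^N$; functions on $\mathbb{T}^N$ are identified with $\mathbb{Z}^N$-periodic functions on $\mathbb{R}^N$. The Lagrangian $L:\mathbb{R}^N\times\mathbb{R}^N\to\mathbb{R}$ is of class $C^2$, $\mathbb{Z}^N$-periodic in $x$, and satisfies: (1) $\lim_{|v|\to\infty}L(x,v)/|v|=+\infty$ uniformly in $x$; (2) the Hessian $\left(\partial^2L/\partial v_i\partial v_j\right)(x,v)$ is positive definite; (3) there are constants $C,\Gamma>0$ with $L(x+y,v-z)+L(x-y,v+z)-2L(x,v)\le C|y|^2+\Gamma|z|^2$ for all $x,y,v,z$. For $\epsilon,h>0$ and continuous $\phi:\mathbb{T}^N\to\mathbb{R}$ set $$\mathcal G[\phi](x)=-\epsilon h\ln\int_{\mathbb{R}^N}e^{-\frac{hL(x,v)+\phi(x+hv)}{\epsilon h}}dv,\qquad \bar{\mathcal G}[\phi](x)=-\epsilon h\ln\int_{\mathbb{R}^N}e^{-\frac{hL(x-hv,v)+\phi(x-hv)}{\epsilon h}}dv.$$ $\phi_{\epsilon,h},\bar\phi_{\epsilon,h}$ are $\mathbb{Z}^N$-periodic Lipschitz functions and $\lambda_{\epsilon,h}\in\mathbb{R}$ is a constant with $\mathcal G[\phi_{\epsilon,h}]=\phi_{\epsilon,h}+\lambda_{\epsilon,h}$ and $\bar{\mathcal G}[\bar\phi_{\epsilon,h}]=\bar\phi_{\epsilon,h}+\lambda_{\epsilon,h}$, normalized by $\phi_{\epsilon,h}(0)=0$ and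 $\int_{\mathbb{T}^N}e^{-\frac{\bar\phi_{\epsilon,h}(x)+\phi_{\epsilon,h}(x)}{\epsilon h}}dx=1$. $\overline H_h=\min_{\mu\in\mathcal M_h}\int L\,d\mu$, where $\mathcal M_h$ is the set of Borel probability measures $\mu$ on $\mathbb{T}^N\times\mathbb{R}^N$ with $\int(\varphi(x+hv)-\varphi(x))\,d\mu=0$ for all $\varphi\in C(\mathbb{T}^N)$. It is known that $\overline H_{\epsilon,h}\to\overline H_h$ as $\epsilon\to0$ with $h$ fixed. *)

(* Defs.v *)
From HB Require Import structures.
From mathcomp Require Import all_boot all_order all_algebra generic_quotient.
From mathcomp Require Import all_classical all_reals all_analysis.
Set Implicit Arguments.
Unset Strict Implicit.
Unset Printing Implicit Defensive.
Import Order.TTheory GRing.Theory Num.Theory.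
Import numFieldNormedType.Exports.
Local Open Scope classical_set_scope.
Local Open Scope ring_scope.
Local Open Scope quotient_scope.

(* R^N is 'rV[R]_N.  The library norm on row vectors is the sup norm; enorm is
   the Euclidean one. *)
Definition enorm (R : realType) (N : nat) (v : 'rV[R]_N) : R :=
  Num.sqrt (\sum_(i < N) v 0 i ^+ 2).

(* Borel sigma-algebra. *)
HB.instance Definition _ (R : realType) (N : nat) :=
  Measurable.copy 'rV[R]_N (g_sigma_algebraType (@open 'rV[R]_N)).

Definition rVcons (R : realType) (N : nat)
    (p : 'rV[R]_N * measurableTypeR R) : 'rV[R]_N.+1 :=
  row_mx ((p.2 : R)%:M : 'rV[R]_1) p.1.

(* Lebesgue measure on R^N, as the iterated product of the one on R. *)
Fixpoint lebesgueN (R : realType) (N : nat) : set 'rV[R]_N -> \bar R :=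
  match N return set 'rV[R]_N -> \bar R with
  | 0%N => \d_ (0 : 'rV[R]_0)
  | N'.+1 => pushforward (lebesgueN (N := N') \x lebesgue_measure)%E
               (@rVcons R N')
  end.
Arguments lebesgueN : clear implicits.

Section torus.
Variables (R : realType) (N : nat).

Definition intvec (k : 'rV[R]_N) : bool := [forall i, k 0 i \is a Num.int].

Definition torus_rel : rel 'rV[R]_N := fun x y => intvec (x - y).

Lemma torus_rel_refl : reflexive torus_rel.
Proof. by move=> x; apply/forallP => i; rewrite subrr mxE rpred0. Qed.

Lemma torus_rel_sym : symmetric torus_rel.
Proof.
by move=> x y; apply: eq_forallb => i; rewrite -opprB mxE rpredN.
Qed.

Lemma torus_rel_trans : transitive torus_rel.
Proof.
move=> y x z /forallP xy /forallP yz; apply/forallP => i.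
by rewrite -(subrKA y) mxE rpredD.
Qed.

Definition torus_equiv :=
  EquivRel _ torus_rel_refl torus_rel_sym torus_rel_trans.

Definition torus := {eq_quot torus_equiv}.

HB.instance Definition _ := PointedTopological.copy torus
  (quotient_topology torus).
HB.instance Definition _ := Quotient.on torus.
HB.instance Definition _ :=
  Measurable.copy torus (g_sigma_algebraType (@open torus)).

Definition unit_cube : set 'rV[R]_N := [set x | forall i, 0 <= x 0 i < 1].

(* Image of the Lebesgue measure of the unit cube under the projection. *)
Definition lebesgueT (A : set torus) : \bar R :=
  lebesgueN R N (unit_cube `&` \pi_torus @^-1` A).

(* The function on T^N (resp. T^N x R^N) identified with a function on R^N
   (resp. R^N x R^N) that is Z^N-periodic in x; for such functions the choice
   of the representative repr q is irrelevant. *)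
Definition on_torus (g : 'rV[R]_N -> R) (q : torus) : R := g (repr q).
Definition on_phase (F : 'rV[R]_N -> 'rV[R]_N -> R)
  (z : torus * 'rV[R]_N) : R := F (repr z.1) z.2.

Definition zperiodic (T : Type) (g : 'rV[R]_N -> T) : Prop :=
  forall x k, intvec k -> g (x + k) = g x.

Definition lipschitz_fun (g : 'rV[R]_N -> R) : Prop :=
  exists K : R, forall x y, `|g x - g y| <= K * enorm (x - y).

Definition bounded_phase (A : set (torus * 'rV[R]_N)) : Prop :=
  exists M : R, forall z, A z -> enorm z.2 <= M.

End torus.

(* In finite dimension, class C^2 is the existence and continuity of all
   directional derivatives of order 1 and 2. *)
Definition classC2 (R : realType) (V : normedModType R) (f : V -> R^o) : Prop :=
  [/\ continuous f,
      forall u, (forall x, derivable f x u) /\ continuous ('D_u f)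
    & forall u w, (forall x, derivable ('D_u f) x w) /\
        continuous ('D_w ('D_u f))].

Section lagrangian.
Variables (R : realType) (N : nat).
Implicit Types (L : 'rV[R]_N -> 'rV[R]_N -> R) (x v : 'rV[R]_N).

Definition hessian_v L x v : 'M[R]_N :=
  \matrix_(i, j) 'D_(delta_mx 0 i) ('D_(delta_mx 0 j) (L x : 'rV[R]_N -> R^o)) v.

Definition posdefmx (A : 'M[R]_N) : Prop :=
  forall z : 'rV[R]_N, z != 0 -> 0 < (z *m A *m z^T) 0 0.

Definition superlinear L : Prop :=
  forall K : R, exists r : R, forall x v, r < enorm v -> K < L x v / enorm v.

Definition semiconcave_type L : Prop :=
  exists C Gamma : R, [/\ 0 < C, 0 < Gamma &
    forall x y v z, L (x + y) (v - z) + L (x - y) (v + z) - 2 * L x v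
      <= C * enorm y ^+ 2 + Gamma * enorm z ^+ 2].

Definition is_lagrangian L : Prop :=
  [/\ classC2 (fun z : 'rV[R]_N * 'rV[R]_N => L z.1 z.2),
      zperiodic L,
      superlinear L,
      forall x v, posdefmx (hessian_v L x v)
    & semiconcave_type L].

(* For continuous periodic phi the integrals below lie in ]0, +oo[, so that the
   values are finite. *)
Definition Gop (eps h : R) L (phi : 'rV[R]_N -> R) x : \bar R :=
  ((- (eps * h))%:E * lne (\int[lebesgueN R N]_v
    (expR (- ((h * L x v + phi (x + h *: v)) / (eps * h))))%:E))%E.

Definition Gbarop (eps h : R) L (phi : 'rV[R]_N -> R) x : \bar R :=
  ((- (eps * h))%:E * lne (\int[lebesgueN R N]_v
    (expR (- ((h * L (x - h *: v) v + phi (x - h *: v)) / (eps * h))))%:E))%E.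

Definition f_eps (h : R) L (phi phib : 'rV[R]_N -> R) (H : R) x v : R :=
  (phib x + phi x) / h + L x v + (phi (x + h *: v) - phi x) / h - H.

Definition mu_eps (eps h : R) L (phi phib : 'rV[R]_N -> R) (H : R)
    (A : set (torus R N * 'rV[R]_N)) : \bar R :=
  (\int[lebesgueT (R:=R) (N:=N) \x lebesgueN R N]_(z in A)
    (expR (- (on_phase (f_eps h L phi phib H) z / eps)))%:E)%E.

Definition rate (h : R) L (phi phib : 'rV[R]_N -> R) (H : R) x v : R :=
  (phib x + phi (x + h *: v)) / h + L x v - H.

(* The product sigma-algebra on T^N x R^N is the Borel one, both factors being
   second countable and carrying their Borel sigma-algebras. *)
Definition holonomic (h : R)
    (mu : probability (torus R N * 'rV[R]_N)%type R) : Prop :=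
  forall g : torus R N -> R, continuous g ->
    (\int[mu]_z (g (\pi_(torus R N) (repr z.1 + h *: z.2)) - g z.1)%:E = 0)%E.

(* H is the minimum of the action over the holonomic measures.  L is bounded
   below, so each action is a well-defined element of ]-oo, +oo]. *)
Definition is_effective_H (h : R) L (H : R) : Prop :=
  let S := [set (\int[mu]_z (on_phase L z)%:E)%E | mu in holonomic h] in
  S H%:E /\ lbound S H%:E.

End lagrangian.

(* Main.v *)
(* The functions f_eps and I_h differ by
   (phib_eps - phib_h)(x) / h + (phi_eps - phi_h)(x + h v) / h
   - (lambda_eps / h - Hbar_h), in which L has cancelled.  Once
   lambda_eps / h --> Hbar_h is known this is small uniformly on the whole phase
   space, and the two bounds are Laplace's method on a bounded set.

   Upper bound on lambda_eps: restricting the integral in the equation for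
   phi_eps to a small ball around v gives
   lambda_eps <= h L(x, v) + phi_h(x + h v) - phi_h(x) + o(1) for all (x, v);
   integrated against a minimizing holonomic measure this is
   lambda_eps <= h Hbar_h + o(1).

   Lower bound on lambda_eps: for small eps every x has a velocity v with
   h L(x, v) + phi_eps(x + h v) <= phi_eps(x) + lambda_eps + delta.  Follow such
   velocities for n steps from 0 and return to 0 on the torus by one more step
   of bounded cost: the uniform measure on this closed orbit is holonomic and
   its action is at most (lambda_eps + delta) / h + O(1 / n). *)
From HB Require Import structures.
Require Import Defs.
From mathcomp Require Import all_boot all_order all_algebra generic_quotient.
From mathcomp Require Import all_classical all_reals all_analysis.
From mathcomp Require Import measurable_realfun lra.
Set Implicit Arguments.
Unset Strict Implicit.
Unset Printing Implicit Defensive.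
Import Order.TTheory GRing.Theory Num.Theory.
Import numFieldNormedType.Exports.
Local Open Scope classical_set_scope.
Local Open Scope ring_scope.
Local Open Scope quotient_scope.

(* The integral is a difference of suprema over simple functions, so this
   monotonicity requires no measurability and no additivity of mu. *)
Lemma le_integral_of_le d (T : measurableType d) (R : realType)
    (mu : set T -> \bar R) (D1 D2 : set T) (f g : T -> \bar R) :
  (forall x, (f \_ D1) x <= (g \_ D2) x)%E ->
  (\int[mu]_(x in D1) f x <= \int[mu]_(x in D2) g x)%E.
Proof.
move=> fg; rewrite /integral.
apply: leeB; apply: ereal_sup_le => _ [k /= kf <-];
  exists k => //= x; apply: le_trans (kf x) _.
- by apply: (@funepos_le _ _ setT); [move=> ? _; exact: fg|rewrite inE].
- by apply: (@funeneg_le _ _ setT); [move=> ? _; exact: fg|rewrite inE].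
Qed.

(** * Second countability and measurability of open sets *)

(** The countable family consists of the balls of radius 1/(n + 1) around the points [f i]. Their
    interiors are taken because a ball of a pseudometric need not be open. *)
Lemma dense_second_countable (R : realType) (T : pseudoMetricType R)
    (I : countType) (f : I -> T) :
  (forall x e, 0 < e -> exists i, ball x e (f i)) -> second_countable (T:=T).
Proof.
move=> fd; exists (range (fun p : I * nat => (ball (f p.1) p.2.+1%:R^-1)^°)).
  by apply: sub_countable (card_image_le _ _) _; exact: countableP.
split=> [_ [p _ <-]|x A]; first exact: open_interior.
move=> /nbhs_ballP[e /= e0 xA].
have [n ne] : exists n : nat, n.+1%:R^-1 < e / 2.
  have [n _ nP] := near_infty_natSinv_lt (PosNum (divr_gt0 e0 (ltr0Sn R 1))).
  by exists n; exact: (nP n (leqnn n)).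
have n0 : 0 < (n.+1%:R^-1 : R) by rewrite invr_gt0.
have [i xi] := fd x (n.+1%:R^-1 / 2) (divr_gt0 n0 (ltr0Sn R 1)).
exists ((ball (f i) n.+1%:R^-1)^°) => /=.
  split; first by exists (i, n).
  apply/nbhs_ballP; exists (n.+1%:R^-1 / 2); first by rewrite /= divr_gt0.
  move=> y xy; rewrite [X in ball _ X](splitr n.+1%:R^-1).
  exact: ball_triangle (ball_sym xi) xy.
move=> y /interior_subset fy; apply: xA.
apply: (@le_ball _ _ _ (n.+1%:R^-1 / 2 + n.+1%:R^-1)); last first.
  exact: ball_triangle xi fy.
by move: ne n0; set r := _^-1 => ne n0; lra.
Qed.

(** An open set of the product is the union of the boxes of basic sets that it contains, and these
    are countably many. This carries Borel measurability of the factors over to product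
    sigma-algebras. *)
Lemma preimage_pair_measurable d (T : measurableType d)
    (T1 T2 : topologicalType) (f : T -> T1) (g : T -> T2) :
  second_countable (T:=T1) -> second_countable (T:=T2) ->
  (forall U, open U -> measurable (f @^-1` U)) ->
  (forall U, open U -> measurable (g @^-1` U)) ->
  forall W : set (T1 * T2), open W ->
    measurable ((fun t => (f t, g t)) @^-1` W).
Proof.
move=> [B1 cB1 [oB1 bB1]] [B2 cB2 [oB2 bB2]] mf mg W oW.
pose I := [set p | [/\ B1 p.1, B2 p.2 & p.1 `*` p.2 `<=` W]].
have cI : countable [set: I].
  rewrite (eq_countable (card_setT I)).
  by apply: sub_countable (countableX cB1 cB2); apply: subset_card_le => -[p q] [].
rewrite [X in measurable X](_ : _ = \bigcup_(p : I)
  (f @^-1` (val p).1 `&` g @^-1` (val p).2)); last first.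
  apply/seteqP; split=> [t /= Wt|t [p _ [/= ft gt]]]; last first.
    by have [_ _] := set_valP p; apply.
  have [[U V] [/= nU nV] UVW] : nbhs (f t, g t) W by exact: open_nbhs_nbhs.
  have [U' [/= BU' U'f] U'U] := bB1 _ _ nU.
  have [V' [/= BV' V'g] V'V] := bB2 _ _ nV.
  have UV'W : I (U', V').
    by split => //= -[a b] [/= /U'U Ua /V'V Vb]; exact: UVW.
  by exists (SigSub (mem_set UV'W)).
apply: countable_bigcupT_measurable => // p; have [p1 p2 _] := set_valP p.
by apply: measurableI; [apply/mf/oB1|apply/mg/oB2].
Qed.

Lemma rat_near (R : realType) (x e : R) :
  0 < e -> exists q : rat, `|x - ratr q| < e.
Proof.
move=> e0; have /rat_in_itvoo[q] : x - e < x + e by lra.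
rewrite in_itv/= => /andP[q1 q2]; exists q.
by rewrite ltr_norml; apply/andP; split; lra.
Qed.

Lemma rV_second_countable (R : realType) (N : nat) :
  second_countable (T:='rV[R]_N).
Proof.
apply: (@dense_second_countable R 'rV[R]_N 'rV[rat]_N (map_mx ratr)) => x e e0.
have [q qP] := choice (fun i => rat_near (x 0 i) e0).
exists (\row_i q i); split=> // i j.
by rewrite !mxE ord1 /ball/=; exact: qP.
Qed.

Lemma real_second_countable (R : realType) : second_countable (T:=R).
Proof.
by apply: (@dense_second_countable R R rat ratr) => x e e0; exact: rat_near.
Qed.

Lemma pi_torus_eq (R : realType) (N : nat) (x y : 'rV[R]_N) :
  \pi_(torus R N) x = \pi_(torus R N) y <-> intvec (x - y).
Proof.
exact: (rwP (eqmodP (torus_equiv R N) x y)).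
Qed.

(** A set of the torus is open when its preimage is, and the preimage of the image of U is the union
    of the integer translates of U. *)
Lemma pi_torus_open (R : realType) (N : nat) (U : set 'rV[R]_N) :
  open U -> open (\pi_(torus R N) @` U).
Proof.
move=> oU; change (open (\pi_(torus R N) @^-1` (\pi_(torus R N) @` U))).
rewrite openE => x [u Uu] /pi_torus_eq xu.
have : nbhs x ((fun y => y + (u - x)) @^-1` U).
  have /continuousP/(_ U oU) oU' : continuous (fun y : 'rV[R]_N => y + (u - x)).
    move=> y; apply: (@cvgD R _ _ (nbhs y) _ id (fun=> u - x) y (u - x)).
      exact: cvg_id.
    exact: cvg_cst.
  by apply: open_nbhs_nbhs; split => //=; rewrite addrC subrK.
apply: filterS => y /= Uy; exists (y + (u - x)) => //.
by apply/pi_torus_eq; rewrite addrC addKr.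
Qed.

Lemma torus_second_countable (R : realType) (N : nat) :
  second_countable (T:=torus R N).
Proof.
have [B cB [oB bB]] := @rV_second_countable R N.
exists ((fun U => \pi_(torus R N) @` U) @` B).
  by apply: sub_countable (card_image_le _ _) _.
split=> [_ [U /oB oU <-]|q A]; first exact: pi_torus_open.
rewrite nbhsE => -[V [oV Vq] VA].
have [|U [/= BU Uq] UV] := bB (repr q) (\pi_(torus R N) @^-1` V).
  by apply: open_nbhs_nbhs; split; [exact: oV|rewrite /= reprK].
exists (\pi_(torus R N) @` U) => /=.
  by split; [exists U|exists (repr q); rewrite ?reprK].
by move=> _ [u Uu <-]; apply: VA; exact: UV.
Qed.

Lemma intvec_reprK (R : realType) (N : nat) (x : 'rV[R]_N) :
  intvec (x - repr (\pi_(torus R N) x)).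
Proof. by apply/pi_torus_eq; rewrite reprK. Qed.

Lemma zperiodic_repr (R : realType) (N : nat) (T : Type)
    (g : 'rV[R]_N -> T) (x : 'rV[R]_N) :
  zperiodic g -> g (repr (\pi_(torus R N) x)) = g x.
Proof.
move=> gP; rewrite -[in RHS](subrK (repr (\pi_(torus R N) x)) x) addrC.
by rewrite gP ?intvec_reprK.
Qed.

(** [repr] need not be continuous, so the argument uses that the projection is open: a neighbourhood
    of [repr q] projects onto one of q, and periodicity replaces the representative selected by
    [repr] with the point of that neighbourhood. *)
Lemma continuous_on_phase (R : realType) (N : nat)
    (F : 'rV[R]_N -> 'rV[R]_N -> R) :
  continuous (fun z : 'rV[R]_N * 'rV[R]_N => F z.1 z.2) -> zperiodic F ->
  continuous (on_phase F : torus R N * 'rV[R]_N -> R).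
Proof.
move=> cF pF [q v]; apply/cvgrPdist_lt => e e0.
have /cvgrPdist_lt/(_ _ e0) := cF (repr q, v).
case=> -[U V] [/= nU nV] UVF.
exists (\pi_(torus R N) @` U°, V).
  split => //=; apply: open_nbhs_nbhs; split.
    exact/pi_torus_open/open_interior.
  by exists (repr q); rewrite ?reprK.
move=> [_ w] [/= [u Uu <-] Vw]; rewrite /on_phase/= zperiodic_repr//.
by apply: (UVF (u, w)); split => //=; exact: interior_subset.
Qed.

Lemma open_rV_measurable (R : realType) (N : nat) (U : set 'rV[R]_N) :
  open U -> measurable U.
Proof. by move=> oU; apply: sub_sigma_algebra. Qed.

Lemma open_torus_measurable (R : realType) (N : nat) (U : set (torus R N)) :
  open U -> measurable U.
Proof. by move=> oU; apply: sub_sigma_algebra. Qed.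

Lemma open_phase_measurable (R : realType) (N : nat)
    (W : set (torus R N * 'rV[R]_N)) :
  open W -> measurable W.
Proof.
have m1 (U : set (torus R N)) : open U ->
    measurable ((fst : torus R N * 'rV[R]_N -> _) @^-1` U).
  move=> oU; rewrite -[X in measurable X]setTI; apply: measurable_fst => //.
  exact: open_torus_measurable.
have m2 (U : set 'rV[R]_N) : open U ->
    measurable ((snd : torus R N * 'rV[R]_N -> _) @^-1` U).
  move=> oU; rewrite -[X in measurable X]setTI; apply: measurable_snd => //.
  exact: open_rV_measurable.
move=> /(preimage_pair_measurable (@torus_second_countable R N)
  (@rV_second_countable R N) m1 m2).
by rewrite (_ : (fun t => _) @^-1` _ = W)//; apply/seteqP; split=> -[].
Qed.

Lemma measurable_on_phase (R : realType) (N : nat)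
    (F : 'rV[R]_N -> 'rV[R]_N -> R) :
  continuous (fun z : 'rV[R]_N * 'rV[R]_N => F z.1 z.2) -> zperiodic F ->
  measurable_fun [set: torus R N * 'rV[R]_N] (on_phase F).
Proof.
move=> cF pF; apply: (measurability _ (RGenOpens.measurableE R)).
move=> _ [_ [a [b ->] <-]]; rewrite setTI; apply: open_phase_measurable.
by move/continuousP: (continuous_on_phase cF pF); apply; exact: interval_open.
Qed.

(** * Lebesgue measure on R^N and on the torus *)

Lemma continuous_row_mx1 (R : realType) (N : nat) :
  continuous (fun p : 'rV[R]_N * R =>
    row_mx (p.2%:M : 'rV[R]_1) p.1 : 'rV[R]_N.+1).
Proof.
move=> p; apply/cvg_ballP => e e0; exists (ball p.1 e, ball p.2 e).
  by split => /=; exact: nbhsx_ballx.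
move=> q [pq1 pq2].
split=> // i j; rewrite !mxE; case: fintype.split => k; rewrite ?mxE ?ord1 ?eqxx//.
by case: pq1 => _; apply.
Qed.

Lemma measurable_rVcons (R : realType) (N : nat) :
  measurable_fun setT (@rVcons R N).
Proof.
apply: measurability; first by [].
move=> _ [U oU <-]; rewrite setTI.
have m1 (V : set 'rV[R]_N) : open V ->
    measurable ((fst : 'rV[R]_N * measurableTypeR R -> _) @^-1` V).
  move=> oV; rewrite -[X in measurable X]setTI; apply: measurable_fst => //.
  exact: sub_sigma_algebra.
have m2 (V : set R) : open V ->
    measurable ((snd : 'rV[R]_N * measurableTypeR R -> _) @^-1` V).
  move=> oV; rewrite -[X in measurable X]setTI; apply: measurable_snd => //.
  exact: open_measurable.
apply: (preimage_pair_measurable (@rV_second_countable R N)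
  (@real_second_countable R) m1 m2 (W :=
  (fun p : 'rV[R]_N * R => row_mx (p.2%:M : 'rV[R]_1) p.1 : 'rV[R]_N.+1) @^-1` U)).
by have /continuousP/(_ U oU) := @continuous_row_mx1 R N.
Qed.

(** [lebesgueN] is a bare set function; realising it inductively as a product measure pushed forward
    along [rVcons] supplies the axioms of a measure. *)
Lemma lebesgueN_measure_subproof (R : realType) (N : nat) :
  exists m : {measure set 'rV[R]_N -> \bar R},
    (m : set 'rV[R]_N -> \bar R) = lebesgueN R N.
Proof.
elim: N => [|N [m mE]]; first by exists (\d_ (0 : 'rV[R]_0)).
exists (measure_function_pushforward__canonical__measure_function_Measure
  (m \x (@lebesgue_measure R))%E (@measurable_rVcons R N)).
by rewrite /= -mE.
Qed.

Lemma lebesgueN0 (R : realType) (N : nat) : lebesgueN R N set0 = 0%E.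
Proof. by have [m <-] := lebesgueN_measure_subproof R N; rewrite measure0. Qed.

Lemma lebesgueN_ge0 (R : realType) (N : nat) A : (0 <= lebesgueN R N A)%E.
Proof. by have [m <-] := lebesgueN_measure_subproof R N. Qed.

Lemma lebesgueN_semi_sigma_additive (R : realType) (N : nat) :
  semi_sigma_additive (lebesgueN R N).
Proof.
have [m <-] := lebesgueN_measure_subproof R N.
exact: measure_semi_sigma_additive.
Qed.

HB.instance Definition _ (R : realType) (N : nat) :=
  isMeasure.Build _ _ _ (lebesgueN R N) (@lebesgueN0 R N)
    (@lebesgueN_ge0 R N) (@lebesgueN_semi_sigma_additive R N).

Lemma rVcons_head (R : realType) (N : nat) (v : 'rV[R]_N) (t : R) :
  rVcons (v, t) 0 (lshift N (0 : 'I_1)) = t.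
Proof. by rewrite /rVcons (@row_mxEl R 1 1 N) mxE. Qed.

Lemma rVcons_tail (R : realType) (N : nat) (v : 'rV[R]_N) (t : R) j :
  rVcons (v, t) 0 (rshift 1 j) = v 0 j.
Proof. by rewrite /rVcons (@row_mxEr R 1 1 N). Qed.

(** Balls are those of the sup norm, that is cubes of side 2r, and [rVcons] splits a cube into one
    of lower dimension and an interval. *)
Lemma lebesgueN_ball (R : realType) (N : nat) (a : 'rV[R]_N) (r : R) :
  0 < r -> lebesgueN R N (ball a r) = ((2 * r) ^+ N)%:E.
Proof.
move=> r0; elim: N a => [|N IH] a.
  (* In dimension 0 the ball is the whole one-point space, of mass 1. *)
  rewrite /= diracE mem_set//; split=> // i [].
  by case.
rewrite /= /pushforward.
pose a1 := @lsubmx R 1 1 N a; pose a2 := @rsubmx R 1 1 N a.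
rewrite [X in product_measure1 _ _ X](_ : _ =
  ball a2 r `*` `]a1 0 0 - r, a1 0 0 + r[%classic).
  rewrite product_measure1E; last 2 first.
  - by apply: open_rV_measurable; exact: ball_open.
  - exact: measurable_itv.
  rewrite /= IH lebesgue_measure_itv/= lte_fin ifT; last by lra.
  by rewrite -EFinB -EFinM exprSr; congr ((_ * _)%:E); lra.
apply/seteqP; split=> -[v t] /=.
  move=> [_ av]; split.
    split=> // i j; have := av i (rshift 1 j).
    by rewrite ord1 rVcons_tail mxE.
  have := av 0 (lshift N (0 : 'I_1)); rewrite rVcons_head !mxE in_itv/=.
  by rewrite /ball/= ltr_norml => /andP[? ?]; apply/andP; split; lra.
rewrite in_itv/= => -[[_ av] /andP[t1 t2]]; split=> // i j.
rewrite [i]ord1 -(@fintype.splitK 1 N j); case: fintype.split => k /=.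
  rewrite [k]ord1 rVcons_head /ball/= ltr_norml.
  by move: t1 t2; rewrite !mxE => ? ?; apply/andP; split; lra.
by rewrite rVcons_tail; have := av 0 k; rewrite mxE.
Qed.

Lemma lebesgueN_sigma_finite (R : realType) (N : nat) :
  sigma_finite setT (lebesgueN R N).
Proof.
exists (fun n => ball 0 n.+1%:R).
  apply/seteqP; split=> // v _.
  exists (Num.truncn `|v|) => //; rewrite -ball_normE/= sub0r normrN.
  by rewrite truncnS_gt.
move=> n; split; first by apply: open_rV_measurable; exact: ball_open.
by rewrite lebesgueN_ball ?ltry.
Qed.

HB.instance Definition _ (R : realType) (N : nat) :=
  Measure_isSigmaFinite.Build _ _ _ (lebesgueN R N)
    (@lebesgueN_sigma_finite R N).

Lemma unit_cube_measurable (R : realType) (N : nat) :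
  measurable (@unit_cube R N).
Proof.
rewrite (_ : unit_cube (R:=R) (N:=N) = \bigcap_(i in [set: 'I_N])
  ((fun x : 'rV[R]_N => x 0 i) @^-1` `[0, 1[%classic)); last first.
  apply/seteqP; split=> [x xc i _|x xc i].
    by rewrite /= in_itv/=; exact: xc.
  by have := xc i I; rewrite /= in_itv/=.
apply: fin_bigcap_measurable => // i _.
have mi : measurable_fun setT (fun x : 'rV[R]_N => x 0 i).
  apply: (measurability _ (RGenOpens.measurableE R)).
  move=> _ [_ [a [b ->] <-]]; rewrite setTI; apply: open_rV_measurable.
  by move/continuousP: (@coord_continuous R 1 N 0 i); apply; exact: interval_open.
by rewrite -[X in measurable X]setTI; apply: mi.
Qed.

Lemma unit_cube_sub_ball (R : realType) (N : nat) :
  @unit_cube R N `<=` ball 0 2.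
Proof.
move=> x xc; split=> // i j; rewrite ord1 mxE /ball/= sub0r normrN.
by have /andP[x0 x1] := xc j; rewrite ger0_norm//; lra.
Qed.

Lemma measurable_pi_torus (R : realType) (N : nat) :
  measurable_fun setT (\pi_(torus R N) : 'rV[R]_N -> torus R N).
Proof.
apply: measurability; first by [].
by move=> _ [U oU <-]; rewrite setTI; exact: open_rV_measurable.
Qed.

Lemma lebesgueT_measure_subproof (R : realType) (N : nat) :
  exists m : {measure set torus R N -> \bar R},
    (m : set (torus R N) -> \bar R) = @lebesgueT R N.
Proof.
exists (measure_function_pushforward__canonical__measure_function_Measure
  (mrestr (lebesgueN R N) (@unit_cube_measurable R N))
  (@measurable_pi_torus R N)).
by apply/funext => A; rewrite /= /pushforward /mrestr setIC.
Qed.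

Lemma lebesgueT0 (R : realType) (N : nat) : @lebesgueT R N set0 = 0%E.
Proof. by have [m <-] := lebesgueT_measure_subproof R N; rewrite measure0. Qed.

Lemma lebesgueT_ge0 (R : realType) (N : nat) A : (0 <= @lebesgueT R N A)%E.
Proof. by have [m <-] := lebesgueT_measure_subproof R N. Qed.

Lemma lebesgueT_semi_sigma_additive (R : realType) (N : nat) :
  semi_sigma_additive (@lebesgueT R N).
Proof.
have [m <-] := lebesgueT_measure_subproof R N.
exact: measure_semi_sigma_additive.
Qed.

HB.instance Definition _ (R : realType) (N : nat) :=
  isMeasure.Build _ _ _ (@lebesgueT R N) (@lebesgueT0 R N)
    (@lebesgueT_ge0 R N) (@lebesgueT_semi_sigma_additive R N).

Lemma lebesgueT_lty (R : realType) (N : nat) (A : set (torus R N)) :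
  measurable A -> (lebesgueT A < +oo)%E.
Proof.
move=> mA; apply: (@le_lt_trans _ _ (lebesgueN R N (ball 0 2))).
  apply: le_measure; rewrite ?inE.
  - apply: measurableI; first exact: unit_cube_measurable.
    by rewrite -[X in measurable X]setTI; apply: measurable_pi_torus.
  - by apply: open_rV_measurable; exact: ball_open.
  - by move=> x [/unit_cube_sub_ball].
by rewrite lebesgueN_ball ?ltry.
Qed.

Lemma floor_in_cube (R : realType) (N : nat) (x : 'rV[R]_N) :
  exists2 y, unit_cube y & \pi_(torus R N) y = \pi_(torus R N) x.
Proof.
exists (\row_i (x 0 i - (Num.floor (x 0 i))%:~R)).
  move=> i; rewrite mxE subr_ge0 ge_floor/=.
  by have := floorD1_gt (x 0 i); rewrite intrD; lra.
apply/pi_torus_eq/forallP => i; rewrite !mxE addrAC subrr add0r rpredN.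
exact: intr_int.
Qed.

(** A nonempty open set contains the product of a projected small cube and a velocity ball. The mass
    of the former is at least the volume of the cube, provided that the cube lies in [unit_cube]. *)
Lemma open_phase_mass (R : realType) (N : nat) (A : set (torus R N * 'rV[R]_N)) :
  open A -> A !=set0 ->
  exists B : set (torus R N * 'rV[R]_N), [/\ measurable B, B `<=` A &
    exists2 V : R, 0 < V &
      ((@lebesgueT R N \x lebesgueN R N) B = V%:E)%E].
Proof.
move=> oA [[q v] Aqv].
have [[U W] [/= nU /nbhs_ballP[r1 /= r10 vW]] UWA] : nbhs (q, v) A.
  exact: open_nbhs_nbhs.
have [y yc yq] := floor_in_cube (repr q); rewrite reprK in yq.
have /nbhs_ballP[r2 /= r20 yU] : nbhs y (\pi_(torus R N) @^-1` U).
  apply: (@filterS _ _ _ (\pi_(torus R N) @^-1` U°)).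
    by move=> w /interior_subset.
  apply: open_nbhs_nbhs; split; first exact: (@open_interior _ U).
  by rewrite /= yq.
(* The bound by r2 keeps the small cube in the preimage of U, the last one keeps it below the upper
   faces of the unit cube. *)
have [r [r0 rr1 rr2 ry]] : exists r : R,
    [/\ 0 < r, r < r1, 2 * r < r2 & forall i, 2 * r < 1 - y 0 i].
  have : \forall r \near (0 : R)^'+,
    [/\ 0 < r, r < r1, 2 * r < r2 & forall i, 2 * r < 1 - y 0 i].
    near=> r; split.
    - by [].
    - by near: r; exact: nbhs_right_lt.
    - rewrite mulrC -ltr_pdivlMr//; near: r; apply: nbhs_right_lt.
      by rewrite divr_gt0.
    - near: r; apply: filter_forall => i; near=> r.
      rewrite mulrC -ltr_pdivlMr//; near: r; apply: nbhs_right_lt.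
      by rewrite divr_gt0// subr_gt0; have /andP[] := yc i.
  by move/filter_ex.
(* The centre is moved up by r in every coordinate: y may lie on a lower face of the half-open unit
   cube, and a cube centred at y would then leave it. *)
pose c : 'rV[R]_N := \row_i (y 0 i + r).
have cbox w i : ball c r w -> y 0 i < w 0 i < y 0 i + 2 * r.
  case=> _ /(_ 0 i); rewrite mxE /ball/= ltr_norml => /andP[? ?].
  by apply/andP; split; lra.
have mB : measurable (\pi_(torus R N) @` ball c r).
  by apply: open_torus_measurable; apply: pi_torus_open; exact: ball_open.
have mv : measurable (ball v r) by apply: open_rV_measurable; exact: ball_open.
exists ((\pi_(torus R N) @` ball c r) `*` ball v r); split.
- exact: measurableX.
- move=> [_ w] [/= [u cu <-] vw]; apply: UWA; split => /=.
    apply: yU; split=> // i j; rewrite ord1 /ball/= distrC ltr_norml.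
    by have /andP[? ?] := cbox _ j cu; apply/andP; split; lra.
  by apply: vW; apply: le_ball vw; exact: ltW.
- have T0 : (0 < lebesgueT (\pi_(torus R N) @` ball c r))%E.
    apply: (@lt_le_trans _ _ (lebesgueN R N (ball c r))).
      by rewrite lebesgueN_ball// lte_fin exprn_gt0// mulr_gt0.
    apply: le_measure; rewrite ?inE //.
    + by apply: open_rV_measurable; exact: ball_open.
    + apply: measurableI; first exact: unit_cube_measurable.
      by rewrite -[X in measurable X]setTI; apply: measurable_pi_torus.
    + move=> w cw; split; last by exists w.
      move=> i; have /andP[? ?] := cbox _ i cw; have := ry i.
      by have /andP[? ?] := yc i => ?; apply/andP; split; lra.
  have Tfin : lebesgueT (\pi_(torus R N) @` ball c r) \is a fin_num.
    by rewrite ge0_fin_numE ?lebesgueT_lty// ltW.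
  exists (fine (lebesgueT (\pi_(torus R N) @` ball c r)) * (2 * r) ^+ N).
    by rewrite mulr_gt0 ?exprn_gt0 ?mulr_gt0// fine_gt0// T0 lebesgueT_lty.
  rewrite product_measure1E//= lebesgueN_ball// EFinM fineK//.
Unshelve. all: by end_near. Qed.

(** * Comparison of norms, and the fixed-point equation as an integral *)

Lemma coord_le_enorm (R : realType) (N : nat) (v : 'rV[R]_N) i :
  `|v 0 i| <= enorm v.
Proof.
rewrite /enorm -sqrtr_sqr; apply: ler_wsqrtr.
by rewrite (bigD1 i)//= lerDl; apply: sumr_ge0 => j _; exact: sqr_ge0.
Qed.

Lemma enorm_le_ball (R : realType) (N : nat) (v : 'rV[R]_N) e :
  0 < e -> ball 0 e v -> enorm v <= Num.sqrt N%:R * e.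
Proof.
move=> e0 [_ ve]; rewrite /enorm -[e in leRHS]gtr0_norm// -sqrtr_sqr.
rewrite -sqrtrM ?ler0n//; apply: ler_wsqrtr.
apply: (@le_trans _ _ (\sum_(i < N) e ^+ 2)).
  apply: ler_sum => i _; rewrite -[leLHS]ger0_norm ?sqr_ge0// normrX.
  rewrite ler_pXn2r ?nnegrE ?normr_ge0 ?ltW//.
  by have := ve 0 i; rewrite mxE /ball/= sub0r normrN.
by rewrite sumr_const card_ord mulr_natl.
Qed.

Lemma lipschitz_fun_continuous (R : realType) (N : nat) (g : 'rV[R]_N -> R) :
  lipschitz_fun g -> continuous g.
Proof.
move=> [K gK] x; apply/(@cvgrPdist_lt _ _ _ _ (nbhs_filter x)) => e e0.
(* The factor sqrt N passes from the Euclidean norm to sup-norm balls; the absolute value and the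
   summand 1 make C positive whatever K is. *)
pose C := `|K| * Num.sqrt N%:R + 1.
have C0 : 0 < C by rewrite ltr_wpDl// mulr_ge0 ?sqrtr_ge0.
apply/nbhs_ballP; exists (e / C); first by rewrite /= divr_gt0.
move=> y xy; apply: le_lt_trans (gK x y) _.
have xyb : ball 0 (e / C) (x - y).
  split=> [|i j]; first by rewrite divr_gt0.
  by case: xy => _ /(_ i j); rewrite !mxE /ball/= sub0r normrN.
apply: (@le_lt_trans _ _ (`|K| * (Num.sqrt N%:R * (e / C)))).
  apply: (@le_trans _ _ (`|K| * enorm (x - y))).
    by rewrite ler_wpM2r ?ler_norm ?sqrtr_ge0.
  by rewrite ler_wpM2l// enorm_le_ball// divr_gt0.
rewrite mulrA mulrCA -[ltRHS]mulr1 ltr_pM2l// ltr_pdivrMr// mul1r.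
by rewrite /C ltrDl.
Qed.

(** A finite value of [Gop] excludes 0 and +oo as values of the integral, since their logarithms are
    infinite; the logarithm can then be inverted. *)
Lemma Gop_integral (R : realType) (N : nat) (eps h c : R) L
    (phi : 'rV[R]_N -> R) x :
  0 < eps -> 0 < h -> Gop eps h L phi x = c%:E ->
  (\int[lebesgueN R N]_v
     (expR (- ((h * L x v + phi (x + h *: v)%R) / (eps * h))))%:E)%E
  = (expR (- (c / (eps * h))))%:E.
Proof.
move=> e0 h0; rewrite /Gop.
set J := (\int[_]_v _)%E.
have J0 : (0 <= J)%E by apply: integral_ge0 => v _; rewrite lee_fin expR_ge0.
have eh : 0 < eps * h by rewrite mulr_gt0.
case: J J0 => [r| |]//=; last by rewrite lt0_muley// lte_fin oppr_lt0.
rewrite lee_fin => r0; case: ifPn => [_|].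
  by rewrite lt0_muleNy// lte_fin oppr_lt0.
rewrite -ltNge => r1 [rc]; congr (_%:E).
rewrite -[LHS]lnK//; congr expR.
by rewrite -rc !mulNr opprK mulrAC mulfV ?mul1r// gt_eqF.
Qed.

(** * Properties inherited by uniform limits *)

Section uniform_limit.
Variables (R : realType) (N : nat) (phi : R -> 'rV[R]_N -> R)
  (phi_h : 'rV[R]_N -> R).
Hypothesis phi_cvg : forall e : R, 0 < e ->
  \forall eps \near (0 : R)^'+, forall x, `|phi eps x - phi_h x| < e.

Lemma uniform_limit_approx e : 0 < e ->
  exists2 eps, 0 < eps & forall x, `|phi eps x - phi_h x| < e.
Proof.
move=> /phi_cvg phie.
have /filter_ex[eps [e0 pe]] : \forall eps \near (0 : R)^'+,
    0 < eps /\ forall x, `|phi eps x - phi_h x| < e.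
  near=> eps; split=> //; near: eps; exact: phie.
by exists eps.
Unshelve. all: by end_near. Qed.

Lemma uniform_limit_continuous :
  (forall eps, 0 < eps -> continuous (phi eps)) -> continuous phi_h.
Proof.
move=> cphi x; apply/(@cvgrPdist_lt _ _ _ _ (nbhs_filter x)) => e e0.
have e3 : 0 < e / 3 by rewrite divr_gt0.
have [eps eps0 pe] := uniform_limit_approx e3.
have /(@cvgrPdist_lt _ _ _ _ (nbhs_filter x))/(_ _ e3) := cphi _ eps0 x.
apply: filterS => y /ltr_normlP[? ?].
have /ltr_normlP[? ?] := pe x; have /ltr_normlP[? ?] := pe y.
by apply/ltr_normlP; split; lra.
Qed.

Lemma uniform_limit_zperiodic :
  (forall eps, 0 < eps -> zperiodic (phi eps)) -> zperiodic phi_h.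
Proof.
move=> pphi x k kint; apply/eqP; rewrite -subr_eq0 -normr_le0.
apply/ler_addgt0Pr => e e0; rewrite add0r.
have e3 : 0 < e / 2 by rewrite divr_gt0.
have [eps eps0 pe] := uniform_limit_approx e3.
have /ltr_normlP[] := pe x; have /ltr_normlP[] := pe (x + k).
rewrite pphi// => ? ? ? ?.
by apply/ler_normlP; split; lra.
Qed.

Lemma uniform_limit_bounded (M : R) :
  (forall eps, 0 < eps -> forall x, `|phi eps x| <= M) ->
  forall x, `|phi_h x| <= M + 1.
Proof.
move=> pM x; have [eps eps0 pe] := uniform_limit_approx ltr01.
have /ltr_normlP[? ?] := pe x; have /ler_normlP[? ?] := pM _ eps0 x.
by apply/ler_normlP; split; lra.
Qed.

End uniform_limit.

(** * Laplace estimate for the fixed-point equation near one velocity *)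

Lemma affine_continuous (R : realType) (N : nat) (x : 'rV[R]_N) (h : R) :
  continuous (fun w : 'rV[R]_N => x + h *: w).
Proof.
move=> w; apply: continuousD; first exact: cst_continuous.
exact: scaler_continuous.
Qed.

(** On a small ball around v, of volume V, the numerator of the exponent is at most [g v + eta / 2]:
    one quarter of eta pays for the variation of g and one for replacing [phi eps] by [phi_h].
    Taking logarithms leaves only the volume term. *)
Lemma laplace_lower (R : realType) (N : nat) (h : R) L (h0 : 0 < h)
    (phi : R -> 'rV[R]_N -> R) (phi_h : 'rV[R]_N -> R) (lambda : R -> R)
    (phi_eq : forall eps : R, 0 < eps ->
       forall x, Gop eps h L (phi eps) x = (phi eps x + lambda eps)%:E)
    (phi_cvg : forall e : R, 0 < e ->
       \forall eps \near (0 : R)^'+, forall x, `|phi eps x - phi_h x| < e)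
    x v eta :
  {for v, continuous (L x)} -> continuous phi_h -> 0 < eta ->
  \forall eps \near (0 : R)^'+,
    phi eps x + lambda eps <= h * L x v + phi_h (x + h *: v) + eta.
Proof.
move=> cL cphi eta0.
pose g w := h * L x w + phi_h (x + h *: w).
have cg : {for v, continuous g}.
  apply: (@continuousD _ R^o _ (fun w => h * L x w : R^o)
    (fun w => phi_h (x + h *: w) : R^o)).
    by apply: continuousM; [exact: cst_continuous|exact: cL].
  exact: (@continuous_comp _ _ _ (fun w => x + h *: w) phi_h _
    (@affine_continuous _ _ x h v) (cphi _)).
have e4 : 0 < eta / 4 by rewrite divr_gt0.
have /(@cvgrPdist_lt _ _ _ _ (nbhs_filter v))/(_ _ e4)/nbhs_ballP[r /= r0 gr] := cg.
pose V := (2 * r) ^+ N.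
have V0 : 0 < V by rewrite exprn_gt0// mulr_gt0.
near=> eps.
have eps0 : 0 < eps by [].
have eh : 0 < eps * h by rewrite mulr_gt0.
have phie : forall x, `|phi eps x - phi_h x| < eta / 4.
  by near: eps; exact: phi_cvg.
(* V does not depend on eps, so this term vanishes with eps and takes the other half of eta. *)
have lnV : eps * h * - ln V <= eta / 2.
  rewrite (@le_trans _ _ (eps * (h * (`|ln V| + 1))))//.
    rewrite -mulrA ler_pM2l// ler_pM2l// -normrN.
    by rewrite (le_trans (ler_norm _))// lerDl.
  rewrite -ler_pdivlMr; last by rewrite mulr_gt0// ltr_wpDl.
  near: eps; apply: nbhs_right_le.
  by rewrite !divr_gt0// mulr_gt0// ltr_wpDl.
have arith (a b b' c d : R) : - (c + d - (a + b)) < eta / 4 ->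
  b' - b < eta / 4 -> a + b' <= c + d + eta / 2 by lra.
have JE := Gop_integral eps0 h0 (phi_eq eps eps0 x).
have : ((expR (- ((g v + eta / 2) / (eps * h))) * V)%:E
        <= (expR (- ((phi eps x + lambda eps) / (eps * h))))%:E)%E.
  rewrite -JE EFinM /V -(lebesgueN_ball v r0) -integral_cst; last first.
    by apply: open_rV_measurable; exact: ball_open.
  apply: le_integral_of_le => w; rewrite !patchE in_setT.
  case: ifPn => [|_]; last by rewrite lee_fin expR_ge0.
  rewrite inE => /gr /ltr_normlP[g1 _].
  rewrite lee_fin ler_expR lerN2 ler_pM2r ?invr_gt0//.
  have /ltr_normlP[_ p2] := phie (x + h *: w).
  exact: arith g1 p2.
rewrite lee_fin -[X in _ * X]lnK// -expRD ler_expR -(ler_pM2l eh) mulrDr !mulrN.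
rewrite !(mulrCA (eps * h)) mulfV ?gt_eqF// !mulr1 => le1.
by rewrite -/(g v); move: lnV; rewrite mulrN; lra.
Unshelve. all: by end_near. Qed.

Lemma continuous_increment (R : realType) (N : nat) (h : R)
    (psi : 'rV[R]_N -> R) :
  continuous psi ->
  continuous (fun z : 'rV[R]_N * 'rV[R]_N => psi (z.1 + h *: z.2) - psi z.1).
Proof.
move=> cpsi z.
apply: (@continuousB _ R^o _ (fun z => psi (z.1 + h *: z.2) : R^o)
  (fun z : 'rV[R]_N * 'rV[R]_N => psi z.1 : R^o)).
  apply: (@continuous_comp _ _ _
    (fun z : 'rV[R]_N * 'rV[R]_N => z.1 + h *: z.2) psi); last exact: cpsi.
  apply: (@continuousD _ 'rV[R]_N _ fst
    (fun z : 'rV[R]_N * 'rV[R]_N => h *: z.2)); first exact: cvg_fst.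
  apply: (@continuous_comp _ _ _ snd (fun v : 'rV[R]_N => h *: v)).
    exact: cvg_snd.
  exact: scaler_continuous.
by apply: (@continuous_comp _ _ _ fst psi); [exact: cvg_fst|exact: cpsi].
Qed.

(** * Integration against a minimizing holonomic measure *)

Lemma holonomic_lower_bound (R : realType) (N : nat)
    (L : 'rV[R]_N -> 'rV[R]_N -> R) (h H c M : R) (psi : 'rV[R]_N -> R) :
  0 < h -> is_effective_H h L H ->
  continuous psi -> zperiodic psi -> (forall x, `|psi x| <= M) ->
  (forall x v, c <= h * L x v + psi (x + h *: v) - psi x) -> c <= h * H.
Proof.
move=> h0 [[mu hmu muE] _] cpsi ppsi bpsi cL.
pose D x v := psi (x + h *: v) - psi x.
have pD : zperiodic D.
  by move=> x k kint; apply/funext => v; rewrite /D addrAC !(ppsi _ k kint).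
have cD := @continuous_increment R N h psi cpsi.
have mD := measurable_on_phase cD pD.
have iD : mu.-integrable setT (EFin \o on_phase D).
  apply: measurable_bounded_integrable => //.
    by have := ltry (1 : R); rewrite -(probability_setT mu).
  exists (M + M); split; first exact: num_real.
  move=> m Mm z _; apply: le_trans (ltW Mm).
  by apply: le_trans (ler_normB _ _) _; rewrite lerD.
have iD0 : (\int[mu]_z (on_phase D z)%:E = 0)%E.
  (* The holonomy condition is tested on psi seen as a function on the torus, which is continuous
     because psi is constant on classes. *)
  rewrite -(hmu (psi \o repr)); last first.
    apply: repr_comp_continuous => // x y /eqP/pi_torus_eq xy.
    by rewrite -(subrK y x) addrC ppsi.
  apply: eq_integral => z _; congr EFin; rewrite /on_phase /D /=.
  by rewrite (zperiodic_repr _ ppsi).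
rewrite mulrC -ler_pdivrMr// -lee_fin -muE.
(* The increment D is bounded, hence integrable, and integrates to 0. Comparing c / h - D / h with L
   pointwise avoids splitting the integral of L. *)
have -> : (c / h)%:E = (\int[mu]_z ((c / h)%:E - (h^-1)%:E * (on_phase D z)%:E))%E.
  rewrite integralB//=; last 2 first.
  - by apply: finite_measure_integrable_cst.
  - by apply: (integrableZl measurableT h^-1 iD).
  rewrite (integralZl measurableT iD) [X in (_ * X)%E]iD0 mule0 sube0.
  by rewrite integral_cst// [X in (_ * X)%E](probability_setT mu) mule1.
apply: le_integral_of_le => z; rewrite !patch_setT -EFinM -EFinB lee_fin.
have := cL (repr z.1) z.2; rewrite /on_phase /D => cLz.
rewrite [h^-1 * _]mulrC -mulrBl ler_pdivrMr// [leRHS]mulrC; lra.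
Qed.

(** * Empirical measures *)

Section empirical.
Context d (T : measurableType d) (R : realType) (z : nat -> T) (n : nat).

Definition empirical : set T -> \bar R :=
  mscale (n.+1%:R^-1)%:nng (msum (fun k => \d_(z k)) n.+1).

HB.instance Definition _ := Measure.on empirical.

Lemma empirical_setT : empirical setT = 1%E.
Proof.
rewrite /empirical /mscale/= /msum (eq_bigr (fun=> 1%:E)) => [|k _]; last first.
  exact: diracT.
by rewrite sumEFin sumr_const card_ord -EFinM mulVf.
Qed.

HB.instance Definition _ :=
  Measure_isProbability.Build _ _ _ empirical empirical_setT.

(** The formula is proved for nonnegative functions and then applied to the positive and negative
    parts of f; both sums are finite, so they can be subtracted. *)
Lemma integral_empirical (f : T -> R) : measurable_fun setT f ->
  (\int[empirical]_x (f x)%:E = (n.+1%:R^-1 * \sum_(k < n.+1) f (z k))%:E)%E.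
Proof.
move=> mf.
have ge0 (g : T -> \bar R) : measurable_fun setT g -> (forall x, 0 <= g x)%E ->
    (\int[empirical]_x g x = (n.+1%:R^-1)%:E * \sum_(k < n.+1) g (z k))%E.
  move=> mg g0; rewrite ge0_integral_mscale//= ge0_integral_measure_sum//.
  congr (_ * _)%E; apply: eq_bigr => k _.
  by rewrite integral_dirac// diracT mul1e.
have mfE : measurable_fun setT (EFin \o f) by exact/measurable_EFinP.
rewrite integralE !ge0//; [|exact: measurable_funeneg|exact: measurable_funepos].
rewrite (eq_bigr (fun k : 'I_n.+1 => (Num.max (f (z k)) 0)%:E)) => [|k _]; last first.
  by rewrite funeposE EFin_max.
rewrite [in X in (_ - X)%E](eq_bigr (fun k : 'I_n.+1 =>
  (Num.max (- f (z k)) 0)%:E)) => [|k _]; last first.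
  by rewrite funenegE EFin_max.
rewrite !sumEFin -!EFinM -EFinB -mulrBr -sumrB; congr ((_ * _)%:E).
apply: eq_bigr => k _; have [fk|fk] := leP (f (z k)) 0.
  by rewrite max_l ?oppr_ge0// sub0r opprK.
by rewrite max_r ?subr0// oppr_le0 ltW.
Qed.
End empirical.

(** * Returning to the origin of the torus at bounded cost *)

Lemma continuous_pair (T U V : topologicalType) (f : T -> U) (g : T -> V) :
  continuous f -> continuous g -> continuous (fun x => (f x, g x)).
Proof. by move=> cf cg x; apply: cvg_pair; [exact: cf|exact: cg]. Qed.

(** If y is the representative of x in the unit cube, v = - y / h moves x to the integer point x -
    y. By periodicity its cost is L(y, - y / h), a continuous function of y, bounded on the compact
    cube [0, 1]^N. *)
Lemma torus_closing_velocity (R : realType) (N : nat) (h : R)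
    (L : 'rV[R]_N -> 'rV[R]_N -> R) :
  0 < h -> continuous (fun z : 'rV[R]_N * 'rV[R]_N => L z.1 z.2) ->
  zperiodic L ->
  exists C, forall x, exists2 v, intvec (x + h *: v) & L x v <= C.
Proof.
move=> h0 cL pL.
pose F y := L y (- h^-1 *: y).
have cF : continuous F.
  move=> y; apply: (@continuous_comp _ _ _ (fun y : 'rV[R]_N => (y, - h^-1 *: y))
    (fun z : 'rV[R]_N * 'rV[R]_N => L z.1 z.2)); last exact: cL.
  by apply: continuous_pair; [by move=> ?; exact: cvg_id|exact: scaler_continuous].
have cK : compact [set y : 'rV[R]_N | forall i, `[0, 1]%classic (y 0 i)].
  by apply: (@rV_compact R N (fun=> `[0, 1]%classic)) => i; exact: segment_compact.
have /compact_bounded[C [_ CP]] : compact ((F : _ -> R^o) @`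
    [set y : 'rV[R]_N | forall i, `[0, 1]%classic (y 0 i)]).
  by apply: continuous_compact => //; exact: continuous_subspaceT.
exists (C + 1) => x.
have [y yc /esym/pi_torus_eq xy] := floor_in_cube x.
exists (- h^-1 *: y).
  by rewrite scaleNr scalerN scalerA mulfV ?gt_eqF// scale1r.
have -> : L x (- h^-1 *: y) = F y by rewrite -[x in LHS](subrK y) addrC pL.
apply: le_trans (ler_norm _) _; apply: (CP (C + 1)); first by rewrite ltrDl.
exists y => //= i; have /andP[y0 y1] := yc i.
by rewrite in_itv/= y0 ltW.
Qed.

Lemma continuous_rV_measurable (R : realType) (N : nat) (f : 'rV[R]_N -> R) :
  continuous f -> measurable_fun setT f.
Proof.
move=> /continuousP cf; apply: (measurability _ (RGenOpens.measurableE R)).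
move=> _ [_ [a [b ->] <-]]; rewrite setTI; apply: open_rV_measurable.
by apply: cf; exact: interval_open.
Qed.

(** * Upper bound on lambda, and near-minimizing velocities *)

Section effective_limit.
Variables (R : realType) (N : nat) (L : 'rV[R]_N -> 'rV[R]_N -> R) (h : R)
  (phi : R -> 'rV[R]_N -> R) (lambda : R -> R) (phi_h : 'rV[R]_N -> R) (M H : R).
Hypotheses (cL : continuous (fun z : 'rV[R]_N * 'rV[R]_N => L z.1 z.2))
  (pL : zperiodic L) (h_gt0 : 0 < h)
  (pphi : forall eps, 0 < eps -> zperiodic (phi eps))
  (cphi : forall eps, 0 < eps -> continuous (phi eps))
  (phi_eq : forall eps : R, 0 < eps ->
     forall x, Gop eps h L (phi eps) x = (phi eps x + lambda eps)%:E)
  (bphi : forall eps : R, 0 < eps -> forall x, `|phi eps x| <= M)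
  (phi_cvg : forall e : R, 0 < e ->
     \forall eps \near (0 : R)^'+, forall x, `|phi eps x - phi_h x| < e)
  (H_min : is_effective_H h L H).

Lemma continuous_fixed_position x : continuous (L x).
Proof.
move=> v; apply: (@continuous_comp _ _ _ (fun v : 'rV[R]_N => (x, v))
  (fun z : 'rV[R]_N * 'rV[R]_N => L z.1 z.2)); last exact: cL.
by apply: continuous_pair; [exact: cst_continuous|by move=> ?; exact: cvg_id].
Qed.

(** The Laplace estimate is not uniform in (x, v), hence the proof by contradiction: if the bound
    fails for arbitrarily small eps, every fixed (x, v) satisfies an inequality free of eps, and
    integrating it gives [h * H + delta <= h * H]. *)
Lemma lambda_upper delta : 0 < delta ->
  \forall eps \near (0 : R)^'+, lambda eps <= h * H + delta.
Proof.
move=> delta0; apply: contrapT => nlam.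
have cphi_h := uniform_limit_continuous phi_cvg cphi.
have pphi_h := uniform_limit_zperiodic phi_cvg pphi.
have bphi_h := uniform_limit_bounded phi_cvg bphi.
suff : h * H + delta <= h * H by rewrite gerDl leNgt delta0.
apply: (holonomic_lower_bound h_gt0 H_min cphi_h pphi_h bphi_h) => x v.
rewrite leNgt; apply/negP => lt; apply: nlam.
(* Half of the assumed gap: one half absorbs the Laplace error, the other the distance from
   [phi eps x] to [phi_h x]. *)
pose eta := (h * H + delta - (h * L x v + phi_h (x + h *: v) - phi_h x)) / 2.
have eta0 : 0 < eta by rewrite divr_gt0// subr_gt0.
near=> eps.
have le1 : phi eps x + lambda eps <= h * L x v + phi_h (x + h *: v) + eta.
  near: eps; exact: (laplace_lower h_gt0 phi_eq phi_cvg
    (@continuous_fixed_position x v)).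
have phie : forall y, `|phi eps y - phi_h y| < eta.
  by near: eps; exact: phi_cvg.
have /ltr_normlP[p1 _] := phie x.
have arith (a b c d e f : R) : a + b <= c + d + (f - (c + d - e)) / 2 ->
  - (a - e) < (f - (c + d - e)) / 2 -> b <= f by lra.
exact: arith le1 p1.
Unshelve. all: by end_near. Qed.

(* If u(v) = h L(x, v) + phi_eps(x + h v) - phi_eps(x) - lambda_eps were > delta
   for all v, then for eps <= 1/2 we would have
   exp(- u / (eps h)) <= exp(- delta / (2 eps h)) exp(- u / h); the integral of
   the left-hand side is 1, and that of exp(- u / h) is bounded uniformly in x
   and eps by the equation for phi_1. *)
Lemma near_minimizer delta : 0 < delta ->
  \forall eps \near (0 : R)^'+, forall x, exists v,
    h * L x v + phi eps (x + h *: v) <= phi eps x + lambda eps + delta.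
Proof.
move=> delta0.
(* Comparing the two integrals will give delta / (2 eps h) <= K / h, that is delta / 2 <= eps K,
   which fails for small eps. The first three M and h H + 1 come from B below, the rest from the
   equation for [phi 1]. *)
pose K := M + M + M + (h * H + 1) + M - lambda 1.
near=> eps => x; apply: contrapT => nv.
have eps0 : 0 < eps by [].
have eh : 0 < eps * h by rewrite mulr_gt0.
have eps2 : eps <= 1 / 2 by near: eps; apply: nbhs_right_le; rewrite divr_gt0.
have lam : lambda eps <= h * H + 1 by near: eps; exact: lambda_upper.
have epsK : eps * (`|K| + 1) < delta / 2.
  rewrite -ltr_pdivlMr; last by rewrite ltr_wpDl.
  by near: eps; apply: nbhs_right_lt; rewrite !divr_gt0// ltr_wpDl.
have u_gt v : delta < h * L x v + phi eps (x + h *: v) - phi eps x - lambda eps.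
  rewrite ltNge; apply/negP => le; apply: nv; exists v; lra.
pose f v := expR (- ((h * L x v + phi 1 (x + h *: v)) / (1 * h))).
pose k := - ((phi eps x + lambda eps) / (eps * h)) - delta / (2 * (eps * h))
  + (M + M + M + (h * H + 1)) / h.
have fle v : expR (- ((h * L x v + phi eps (x + h *: v)) / (eps * h)))
    <= expR k * f v.
  rewrite -expRD ler_expR mul1r.
  pose u := h * L x v + phi eps (x + h *: v) - phi eps x - lambda eps.
  have ud : delta < u := u_gt v.
  have u0 : 0 < u by exact: lt_trans ud.
  have -> : h * L x v + phi eps (x + h *: v) = u + (phi eps x + lambda eps).
    by rewrite /u; lra.
  (* Half of u / (eps h) is bounded below through u > delta, the other half through eps <= 1/2. *)
  have A : delta / (2 * (eps * h)) + u / h <= u / (eps * h).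
    have eh2 : 0 < 2 * (eps * h) by rewrite mulr_gt0.
    rewrite -(ler_pM2r eh2) mulrDl divfK ?gt_eqF//.
    have -> : u / h * (2 * (eps * h)) = u * (2 * eps).
      by rewrite (mulrC eps h) (mulrCA 2 h) -mulrA mulKf ?gt_eqF.
    have -> : u / (eps * h) * (2 * (eps * h)) = u * 2.
      by rewrite mulrCA divfK ?gt_eqF// mulrC.
    have : u * (2 * eps) <= u by rewrite ler_piMr; lra.
    by lra.
  (* Three values of [phi] are bounded by M, and [lambda eps] by h H + 1. *)
  have B : (h * L x v + phi 1 (x + h *: v)) / h
      <= u / h + (M + M + M + (h * H + 1)) / h.
    rewrite -mulrDl ler_pM2r ?invr_gt0//.
    have /ler_normlP[_ b1] := bphi ltr01 (x + h *: v).
    have /ler_normlP[b2 _] := bphi eps0 (x + h *: v).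
    have /ler_normlP[_ b3] := bphi eps0 x.
    by rewrite /u; lra.
  by rewrite /k mulrDl; lra.
have mf : measurable_fun setT (fun v => (f v)%:E).
  apply/measurable_EFinP; apply: measurableT_comp; first exact: measurable_expR.
  apply: continuous_rV_measurable => v; apply: (@continuousN _ R^o _
    (fun v => (h * L x v + phi 1 (x + h *: v)) / (1 * h) : R^o)).
  apply: (@continuousM _ _ (fun v => h * L x v + phi 1 (x + h *: v))
    (fun=> (1 * h)^-1)); last exact: cst_continuous.
  apply: (@continuousD _ R^o _ (fun w => h * L x w : R^o)
    (fun w => phi 1 (x + h *: w) : R^o)).
    apply: continuousM; first exact: cst_continuous.
    exact: continuous_fixed_position.
  apply: (@continuous_comp _ _ _ (fun w => x + h *: w) (phi 1)).
    exact: affine_continuous.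
  exact: cphi.
have : ((expR (- ((phi eps x + lambda eps) / (eps * h))))%:E
    <= (expR (k - (phi 1 x + lambda 1) / (1 * h)))%:E)%E.
  rewrite -(Gop_integral eps0 h_gt0 (phi_eq eps0 x)) expRD EFinM.
  rewrite -(Gop_integral ltr01 h_gt0 (phi_eq ltr01 x)).
  rewrite -ge0_integralZl//.
  apply: le_integral_of_le => v; rewrite !patch_setT -EFinM lee_fin; exact: fle.
rewrite lee_fin ler_expR mul1r /k => le1.
have le2 : delta / (2 * (eps * h)) <= K / h.
  have : (M + M + M + (h * H + 1)) / h - (phi 1 x + lambda 1) / h <= K / h.
    rewrite -mulrBl ler_pM2r ?invr_gt0//.
    by have /ler_normlP[b1 _] := bphi ltr01 x; rewrite /K; lra.
  by move: le1; lra.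
have le3 : delta / 2 <= eps * K.
  have -> : delta / 2 = delta / (2 * (eps * h)) * (eps * h).
    by rewrite invfM (mulrA delta) divfK ?gt_eqF.
  have -> : eps * K = K / h * (eps * h) by rewrite mulrCA divfK ?gt_eqF.
  by rewrite ler_pM2r.
have : eps * K <= eps * (`|K| + 1).
  by rewrite ler_pM2l// (le_trans (ler_norm _))// lerDl.
by lra.
Unshelve. all: by end_near. Qed.
End effective_limit.

(** * Lower bound on lambda from closed orbits, and the limit of lambda / h *)

(** Along the orbit the values of psi telescope, so n steps cost at most n c + 2 M and the closing
    step at most h C. The average action of the n + 1 steps is at least H, and n is arbitrary. *)
Lemma holonomic_upper_bound (R : realType) (N : nat)
    (L : 'rV[R]_N -> 'rV[R]_N -> R) (h H c M : R) (psi : 'rV[R]_N -> R) :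
  0 < h -> continuous (fun z : 'rV[R]_N * 'rV[R]_N => L z.1 z.2) ->
  zperiodic L -> is_effective_H h L H -> (forall x, `|psi x| <= M) ->
  (forall x, exists v, h * L x v + psi (x + h *: v) <= psi x + c) ->
  h * H <= c.
Proof.
move=> h0 cL pL [_ H_lb] bpsi /choice[vel velP].
have [C closeP] := torus_closing_velocity h0 cL pL.
pose x_ k := iter k (fun x => x + h *: vel x) 0.
have step n : (n.+1)%:R * (h * H) <= n%:R * c + (M + M) + h * C.
  have [u uint uC] := closeP (x_ n).
  (* The step of index n, the last one, uses the closing velocity. *)
  pose w k := if (k < n)%N then vel (x_ k) else u.
  pose z k := (\pi_(torus R N) (x_ k), w k).
  have on_phase_z (F : 'rV[R]_N -> 'rV[R]_N -> R) : zperiodic F ->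
      forall k, on_phase F (z k) = F (x_ k) (w k).
    by move=> pF k; rewrite /on_phase/= (zperiodic_repr (x_ k) pF).
  have hol : holonomic h (empirical R z n : probability _ R).
    move=> g cg.
    pose G := g \o \pi_(torus R N).
    have cG : continuous G by apply/quotient_continuous.
    have pG : zperiodic G.
      move=> x k kint; rewrite /G/=; congr (g _).
      by apply/pi_torus_eq; rewrite addrC addKr.
    pose D x v := G (x + h *: v) - G x.
    have pD : zperiodic D.
      by move=> x k kint; apply/funext => v; rewrite /D addrAC !(pG _ k kint).
    have cD : continuous (fun z : 'rV[R]_N * 'rV[R]_N => D z.1 z.2).
      exact: continuous_increment.
    rewrite (eq_integral (fun y => (on_phase D y)%:E)); last first.
      by move=> y _; rewrite /on_phase /D /G/= reprK.
    rewrite integral_empirical; last exact: measurable_on_phase.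
    rewrite (_ : (\sum_(k < n.+1) _)%R = 0) ?mulr0//.
    under eq_bigr do rewrite on_phase_z//.
    rewrite big_ord_recr/= /D /w ltnn.
    rewrite (eq_bigr (fun k : 'I_n => G (x_ k.+1) - G (x_ k))) => [|k _]; last first.
      by rewrite ltn_ord.
    rewrite -(big_mkord xpredT (fun k => G (x_ k.+1) - G (x_ k))) telescope_sumr//.
    (* The orbit starts at 0 and ends at an integer point, so the telescoping sum closes up on the
       torus. *)
    have -> : G (x_ n + h *: u) = G (x_ 0%N).
      rewrite /G/=; congr (g _).
      by apply/pi_torus_eq; rewrite subr0.
    by rewrite addrC subrKA subrr.
  have := H_lb (\int[empirical R z n]_y (on_phase L y)%:E)%E.
  rewrite integral_empirical; last exact: measurable_on_phase.
  have ex : [set (\int[mu]_z (on_phase L z)%:E)%E | mu in holonomic h]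
      (n.+1%:R^-1 * \sum_(k < n.+1) on_phase L (z k))%:E.
    exists (empirical R z n : probability _ R) => //.
    by rewrite integral_empirical//; exact: measurable_on_phase.
  move=> /(_ ex); rewrite lee_fin mulrC ler_pdivlMr ?ltr0n// => HL.
  have sumle m : (m <= n)%N ->
      \sum_(k < m) h * L (x_ k) (w k) <= m%:R * c + psi (x_ 0%N) - psi (x_ m).
    elim: m => [_|m IH mn]; first by rewrite big_ord0 mul0r add0r subrr.
    rewrite big_ord_recr/= {2}/w mn.
    have := IH (ltnW mn); have := velP (x_ m); rewrite -[m.+1]addn1 natrD mulrDl mul1r.
    by lra.
  rewrite mulrC -mulrA.
  apply: le_trans (ler_wpM2l (ltW h0) HL) _.
  under eq_bigr do rewrite on_phase_z//.
  rewrite big_ord_recr/= {2}/w ltnn mulrDr mulr_sumr.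
  have := sumle n (leqnn n); have := ler_wpM2l (ltW h0) uC.
  have /ler_normlP[_ b1] := bpsi (x_ 0%N); have /ler_normlP[b2 _] := bpsi (x_ n).
  by lra.
rewrite leNgt; apply/negP => cH.
pose a := h * H - c.
have a0 : 0 < a by rewrite subr_gt0.
(* [step m] reads m a <= B after rearrangement; m is taken beyond |B| / a to contradict it. *)
pose B := M + M + h * C - h * H.
pose m := (Num.truncn (`|B| / a)).+1.
have : B < m%:R * a.
  rewrite -ltr_pdivrMr//; apply: le_lt_trans (truncnS_gt _).
  by rewrite ler_pM2r ?invr_gt0// ler_norm.
by have := step m; rewrite -natr1 /B /a; set r := m%:R; lra.
Qed.

(** The lower half applies the closed-orbit bound with psi = [phi eps] and c = [lambda eps + h * e],
    since near-minimizing velocities exist at every x once eps is small. *)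
Lemma effective_H_limit (R : realType) (N : nat)
    (L : 'rV[R]_N -> 'rV[R]_N -> R) (h : R)
    (phi : R -> 'rV[R]_N -> R) (lambda : R -> R) (phi_h : 'rV[R]_N -> R)
    (M H : R) :
  continuous (fun z : 'rV[R]_N * 'rV[R]_N => L z.1 z.2) -> zperiodic L ->
  0 < h ->
  (forall eps, 0 < eps -> zperiodic (phi eps)) ->
  (forall eps, 0 < eps -> continuous (phi eps)) ->
  (forall eps : R, 0 < eps ->
     forall x, Gop eps h L (phi eps) x = (phi eps x + lambda eps)%:E) ->
  (forall eps : R, 0 < eps -> forall x, `|phi eps x| <= M) ->
  (forall e : R, 0 < e ->
     \forall eps \near (0 : R)^'+, forall x, `|phi eps x - phi_h x| < e) ->
  is_effective_H h L H ->
  lambda eps / h @[eps --> 0^'+] --> H.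
Proof.
move=> cL pL h0 pphi cphi phi_eq bphi phi_cvg H_min.
apply/cvgrPdist_le => e e0.
have he : 0 < h * e by rewrite mulr_gt0.
near=> eps.
have up : lambda eps <= h * H + h * e.
  by near: eps; exact: (lambda_upper cL h0 pphi cphi phi_eq bphi phi_cvg H_min).
have lo : h * H <= lambda eps + h * e.
  have eps0 : 0 < eps by [].
  apply: (holonomic_upper_bound h0 cL pL H_min (bphi _ eps0)) => x.
  suff : forall x, exists v,
    h * L x v + phi eps (x + h *: v) <= phi eps x + lambda eps + h * e.
    by move=> /(_ x)[v vP]; exists v; rewrite addrA.
  near: eps; exact: (near_minimizer cL h0 pphi cphi phi_eq bphi phi_cvg H_min).
have u2 : lambda eps / h <= H + e by rewrite ler_pdivrMr//; lra.
have l2 : H - e <= lambda eps / h by rewrite ler_pdivlMr//; lra.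
by apply/ler_normlP; split; lra.
Unshelve. all: by end_near. Qed.

(** * Laplace's method on the phase space *)

Lemma limf_esup_le (T : choiceType) (X : filteredType T) (R : realType)
    (f : X -> \bar R) (F : set_system X) (c : \bar R) :
  F [set t | (f t <= c)%E] -> (limf_esup f F <= c)%E.
Proof.
move=> Fc; apply: (@le_trans _ _ (ereal_sup (f @` [set t | (f t <= c)%E]))).
  by apply: ereal_inf_lbound; exists [set t | (f t <= c)%E].
by apply: ge_ereal_sup => _ [t /= tc <-].
Qed.

Lemma le_limf_einf (T : choiceType) (X : filteredType T) (R : realType)
    (f : X -> \bar R) (F : set_system X) (c : \bar R) :
  F [set t | (c <= f t)%E] -> (c <= limf_einf f F)%E.
Proof.
move=> Fc; rewrite limf_einfE.
apply: le_ereal_sup_tmp; exists (ereal_inf (f @` [set t | (c <= f t)%E])).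
  by exists [set t | (c <= f t)%E].
by apply: le_ereal_inf_tmp => _ [t /= tc <-].
Qed.

(** A lies in a box of finite volume, the whole torus times a cube. V is fixed before F, c and eps,
    so that [eps * ln V] tends to 0. *)
Lemma laplace_upper_bounded (R : realType) (N : nat)
    (A : set (torus R N * 'rV[R]_N)) :
  bounded_phase A -> exists2 V : R, 0 < V &
  forall (F : torus R N * 'rV[R]_N -> R) c eps, 0 < eps ->
    (forall z, A z -> c <= F z) ->
    (\int[@lebesgueT R N \x lebesgueN R N]_(z in A) (expR (- (F z / eps)))%:E
     <= (expR (- (c / eps)) * V)%:E)%E.
Proof.
move=> [M AM]; pose r := `|M| + 1.
have r0 : 0 < r by rewrite ltr_wpDl.
pose B : set (torus R N * 'rV[R]_N) := setT `*` ball 0 r.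
have mB : measurable B.
  apply: measurableX => //; apply: open_rV_measurable; exact: ball_open.
have Tfin : lebesgueT [set: torus R N] \is a fin_num.
  by rewrite ge0_fin_numE// lebesgueT_lty.
pose V := fine (lebesgueT [set: torus R N]) * (2 * r) ^+ N.
have BV : ((@lebesgueT R N \x lebesgueN R N) B = V%:E)%E.
  rewrite product_measure1E//=; last first.
    by apply: open_rV_measurable; exact: ball_open.
  by rewrite lebesgueN_ball// EFinM fineK.
have V0 : 0 <= V.
  by rewrite mulr_ge0 ?fine_ge0// exprn_ge0// mulr_ge0// ltW.
(* The summand 1 makes the constant positive, so that its logarithm can be taken. *)
exists (V + 1) => [|F c eps eps0 cF]; first by rewrite ltr_wpDl.
apply: (@le_trans _ _ (expR (- (c / eps)) * V)%:E); last first.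
  by rewrite lee_fin ler_wpM2l ?expR_ge0// lerDl.
rewrite EFinM -BV -integral_cst//.
apply: le_integral_of_le => z; rewrite !patchE.
case: ifPn => [|_]; last by case: ifPn => // _; rewrite lee_fin expR_ge0.
rewrite inE => Az; rewrite mem_set; last first.
  split => //; split=> // i j; rewrite ord1 mxE /ball/= sub0r normrN.
  apply: le_lt_trans (coord_le_enorm _ _) _; apply: le_lt_trans (AM z Az) _.
  by rewrite /r (le_lt_trans (ler_norm _))// ltrDl.
by rewrite lee_fin ler_expR lerN2 ler_pM2r ?invr_gt0//; exact: cF.
Qed.

(** A plays the part of a small open set where F is nearly minimal, [A'] that of the set whose
    measure is estimated. V depends on A alone. *)
Lemma laplace_lower_open (R : realType) (N : nat)
    (A : set (torus R N * 'rV[R]_N)) :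
  open A -> A !=set0 -> exists2 V : R, 0 < V &
  forall (F : torus R N * 'rV[R]_N -> R) A' c eps, 0 < eps -> A `<=` A' ->
    (forall z, A z -> F z <= c) ->
    ((expR (- (c / eps)) * V)%:E <=
     \int[@lebesgueT R N \x lebesgueN R N]_(z in A') (expR (- (F z / eps)))%:E)%E.
Proof.
move=> oA A0; have [B [mB BA [V V0 BV]]] := open_phase_mass oA A0.
exists V => // F A' c eps eps0 AA' cF.
rewrite EFinM -BV -integral_cst//.
apply: le_integral_of_le => z; rewrite !patchE.
case: ifPn => [|_]; last by case: ifPn => // _; rewrite lee_fin expR_ge0.
rewrite inE => /BA Az; rewrite mem_set; last exact: AA'.
by rewrite lee_fin ler_expR lerN2 ler_pM2r ?invr_gt0//; exact: cF.
Qed.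

Lemma eps_ln_expRM (R : realType) (eps c V : R) : 0 < eps -> 0 < V ->
  eps * ln (expR (- (c / eps)) * V) = - c + eps * ln V.
Proof.
move=> e0 V0; rewrite lnM ?posrE ?expR_gt0// expRK mulrDr mulrN mulrCA.
by rewrite mulfV ?gt_eqF// mulr1.
Qed.

Lemma near_eps_mul_small (R : realType) (a delta : R) : 0 < delta ->
  \forall eps \near (0 : R)^'+, `|eps * a| <= delta.
Proof.
move=> d0; near=> eps.
have eps0 : 0 < eps by [].
have a0 : 0 < `|a| + 1 by rewrite ltr_wpDl.
rewrite normrM gtr0_norm//; apply: (@le_trans _ _ (eps * (`|a| + 1))).
  by rewrite ler_pM2l// lerDl.
rewrite -ler_pdivlMr//; near: eps; apply: nbhs_right_le.
by rewrite divr_gt0.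
Unshelve. all: by end_near. Qed.

(** Testing against reals below y treats finite values together with y = +oo, the infimum over an
    empty set. *)
Lemma lee_opp_of_real_lt (R : realType) (x y : \bar R) :
  (forall c : R, (c%:E < y)%E -> (x <= - c%:E)%E) -> (x <= - y)%E.
Proof.
case: y => [r| |] xle; last by rewrite leey.
- apply/lee_addgt0Pr => e e0.
  have := xle (r - e); rewrite lte_fin ltrBlDr ltrDl => /(_ e0).
  by rewrite -!EFinN -EFinD opprB addrC.
- case: x xle => [s| |] xle //=.
    have := xle (1 - s) (ltry _); rewrite -EFinN lee_fin => le; exfalso; lra.
  exact: xle 0 (ltry _).
Qed.

(** * Continuity and periodicity of the rate function *)

Lemma rate_continuous (R : realType) (N : nat) (h : R) L
    (phi phib : 'rV[R]_N -> R) H :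
  continuous (fun z : 'rV[R]_N * 'rV[R]_N => L z.1 z.2) ->
  continuous phi -> continuous phib ->
  continuous (fun z : 'rV[R]_N * 'rV[R]_N => rate h L phi phib H z.1 z.2).
Proof.
move=> cL cphi cphib z.
have c1 := @continuous_increment R N h phi cphi z.
have c2 : {for z, continuous (fun z : 'rV[R]_N * 'rV[R]_N => phi z.1)}.
  by apply: (@continuous_comp _ _ _ fst phi); [exact: cvg_fst|exact: cphi].
have c3 : {for z, continuous (fun z : 'rV[R]_N * 'rV[R]_N => phib z.1)}.
  by apply: (@continuous_comp _ _ _ fst phib); [exact: cvg_fst|exact: cphib].
rewrite (_ : (fun z : 'rV[R]_N * 'rV[R]_N => rate h L phi phib H z.1 z.2) =
  (fun z => h^-1 * (phib z.1 + (phi (z.1 + h *: z.2) - phi z.1 + phi z.1))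
            + L z.1 z.2 + (- H))); last first.
  by apply/funext => y; rewrite /rate subrK mulrC.
apply: (@continuousD _ R^o _ (fun z : 'rV[R]_N * 'rV[R]_N =>
  h^-1 * (phib z.1 + (phi (z.1 + h *: z.2) - phi z.1 + phi z.1)) + L z.1 z.2 : R^o)
  (fun=> - H : R^o)); last exact: cst_continuous.
apply: (@continuousD _ R^o _ (fun z : 'rV[R]_N * 'rV[R]_N =>
  h^-1 * (phib z.1 + (phi (z.1 + h *: z.2) - phi z.1 + phi z.1)) : R^o)
  (fun z => L z.1 z.2 : R^o)); last exact: cL.
apply: continuousM; first exact: cst_continuous.
apply: (@continuousD _ R^o _ (fun z : 'rV[R]_N * 'rV[R]_N => phib z.1 : R^o)
  (fun z => (phi (z.1 + h *: z.2) - phi z.1) + phi z.1 : R^o)) => //.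
by apply: (@continuousD _ R^o _ (fun z : 'rV[R]_N * 'rV[R]_N =>
  phi (z.1 + h *: z.2) - phi z.1 : R^o) (fun z => phi z.1 : R^o)).
Qed.

Lemma rate_zperiodic (R : realType) (N : nat) (h : R) L
    (phi phib : 'rV[R]_N -> R) H :
  zperiodic L -> zperiodic phi -> zperiodic phib ->
  zperiodic (rate h L phi phib H).
Proof.
move=> pL pphi pphib x k kint; apply/funext => v.
by rewrite /rate pL// pphib// (addrAC x k) (pphi _ k kint).
Qed.

(** * The large deviation bounds for closed and for open bounded sets *)

Theorem theorem7 (R : realType) (N : nat) (hN : (0 < N)%N)
  (L : 'rV[R]_N -> 'rV[R]_N -> R) (hL : is_lagrangian L)
  (h : R) (h_gt0 : 0 < h)
  (phi phib : R -> 'rV[R]_N -> R) (lambda : R -> R)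
  (phi_periodic : forall eps : R, 0 < eps ->
     zperiodic (phi eps) /\ zperiodic (phib eps))
  (phi_lipschitz : forall eps : R, 0 < eps ->
     lipschitz_fun (phi eps) /\ lipschitz_fun (phib eps))
  (phi_eq : forall eps : R, 0 < eps ->
     forall x, Gop eps h L (phi eps) x = (phi eps x + lambda eps)%:E)
  (phib_eq : forall eps : R, 0 < eps ->
     forall x, Gbarop eps h L (phib eps) x = (phib eps x + lambda eps)%:E)
  (phi_norm : forall eps : R, 0 < eps -> phi eps 0 = 0)
  (phib_norm : forall eps : R, 0 < eps ->
     (\int[lebesgueT (R:=R) (N:=N)]_q (expR (- (on_torus
        (fun x => (phib eps x + phi eps x) / (eps * h)) q)))%:E = 1)%E)
  (phi_bounded : exists M : R, forall eps : R, 0 < eps ->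
     forall x, `|phi eps x| <= M /\ `|phib eps x| <= M)
  (phi_h phib_h : 'rV[R]_N -> R)
  (phi_cvg : forall e : R, 0 < e ->
     \forall eps \near (0 : R)^'+, forall x, `|phi eps x - phi_h x| < e)
  (phib_cvg : forall e : R, 0 < e ->
     \forall eps \near (0 : R)^'+, forall x, `|phib eps x - phib_h x| < e)
  (Hbar_h : R) (Hbar_h_min : is_effective_H h L Hbar_h) :
  let mu (eps : R) : set (torus R N * 'rV[R]_N) -> \bar R :=
    mu_eps eps h L (phi eps) (phib eps) (lambda eps / h) in
  let infI (A : set (torus R N * 'rV[R]_N)) : \bar R :=
    ereal_inf [set (on_phase (rate h L phi_h phib_h Hbar_h) z)%:E | z in A] in
  (forall A : set (torus R N * 'rV[R]_N), closed A -> bounded_phase A ->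
     (limf_esup (fun eps : R => eps%:E * lne (mu eps A)) 0^'+ <= - infI A)%E) /\
  (forall A : set (torus R N * 'rV[R]_N), open A -> bounded_phase A ->
     (- infI A <= limf_einf (fun eps : R => eps%:E * lne (mu eps A)) 0^'+)%E).
Proof.
have [[cL _ _] pL _ _ _] := hL.
have [M bM] := phi_bounded.
have pphi eps : 0 < eps -> zperiodic (phi eps) by case/phi_periodic.
have pphib eps : 0 < eps -> zperiodic (phib eps) by case/phi_periodic.
have cphi eps : 0 < eps -> continuous (phi eps).
  by case/phi_lipschitz => /lipschitz_fun_continuous.
have cphib eps : 0 < eps -> continuous (phib eps).
  by case/phi_lipschitz => _ /lipschitz_fun_continuous.
have bphi eps : 0 < eps -> forall x, `|phi eps x| <= M.
  by move=> e0 x; have [] := bM _ e0 x.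
have lim_H := effective_H_limit cL pL h_gt0 pphi cphi phi_eq bphi phi_cvg
  Hbar_h_min.
move=> mu infI.
pose I := on_phase (rate h L phi_h phib_h Hbar_h).
pose f eps := on_phase (f_eps h L (phi eps) (phib eps) (lambda eps / h)).
have cI : continuous I.
  apply: continuous_on_phase.
    apply: rate_continuous => //.
      exact: uniform_limit_continuous phi_cvg cphi.
    exact: uniform_limit_continuous phib_cvg cphib.
  apply: rate_zperiodic => //.
    exact: uniform_limit_zperiodic phi_cvg pphi.
  exact: uniform_limit_zperiodic phib_cvg pphib.
have close delta : 0 < delta ->
    \forall eps \near (0 : R)^'+, forall z, `|f eps z - I z| <= delta.
  move=> d0; have d3 : 0 < delta / 3 by rewrite divr_gt0.
  have d3h : 0 < h * (delta / 3) by rewrite mulr_gt0.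
  near=> eps => -[q v]; rewrite /f /I /on_phase/=; set x := repr q.
  have phie : forall y, `|phi eps y - phi_h y| < h * (delta / 3).
    by near: eps; exact: phi_cvg.
  have phibe : forall y, `|phib eps y - phib_h y| < h * (delta / 3).
    by near: eps; exact: phib_cvg.
  have Hle : `|Hbar_h - lambda eps / h| <= delta / 3.
    by near: eps; move/cvgrPdist_le: lim_H; exact.
  (* Both [L x v] and [phi eps x] cancel; each remaining difference is at most delta / 3, uniformly
     in v. *)
  rewrite (_ : _ - _ = (phib eps x - phib_h x) / h
    + (phi eps (x + h *: v) - phi_h (x + h *: v)) / h
    + (Hbar_h - lambda eps / h)); last first.
    by rewrite /f_eps /rate !mulrDl !mulNr; lra.
  apply: le_trans (ler_normD _ _) _.
  apply: (@le_trans _ _ (delta / 3 + delta / 3 + delta / 3)); last by lra.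
  apply: lerD => //; apply: le_trans (ler_normD _ _) _; apply: lerD.
    rewrite normrM normfV (gtr0_norm h_gt0) ler_pdivrMr// [leRHS]mulrC.
    exact/ltW/phibe.
  rewrite normrM normfV (gtr0_norm h_gt0) ler_pdivrMr// [leRHS]mulrC.
  exact/ltW/phie.
split=> A tA bA.
- have [V V0 muV] := laplace_upper_bounded bA.
  (* The infimum is replaced by a real c below it. Half of the slack d pays for the distance from
     [f eps] to I, half for [eps * ln V]. *)
  apply: lee_opp_of_real_lt => c cinf; apply/lee_addgt0Pr => d d0.
  have dpos : 0 < d / 2 by rewrite divr_gt0.
  apply: limf_esup_le; near=> eps.
  have eps0 : 0 < eps by [].
  have fI : forall z, `|f eps z - I z| <= d / 2 by near: eps; exact: (close _ dpos).
  have lnV : `|eps * ln V| <= d / 2 by near: eps; exact: near_eps_mul_small.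
  have mule : (mu eps A <= (expR (- ((c - d / 2) / eps)) * V)%:E)%E.
    apply: muV => // z Az.
    have : c < I z.
      rewrite -lte_fin; apply: lt_le_trans cinf _.
      by apply: ereal_inf_lbound; exists z.
    have /ler_normlP[? ?] := fI z; rewrite -/(f eps z); lra.
  apply: (@le_trans _ _ (eps%:E * lne (expR (- ((c - d / 2) / eps)) * V)%:E)%E).
    apply: lee_wpmul2l; first by rewrite lee_fin ltW.
    rewrite lee_lne//; rewrite in_itv/= leey andbT.
      by apply: integral_ge0 => z _; rewrite lee_fin expR_ge0.
    by rewrite lee_fin mulr_ge0 ?expR_ge0// ltW.
  rewrite lne_EFin; last by rewrite mulr_gt0 ?expR_gt0.
  rewrite -EFinM eps_ln_expRM// -EFinN -EFinD lee_fin.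
  by have /ler_normlP[? ?] := lnV; lra.
- rewrite leeNl; apply: le_ereal_inf_tmp => _ [z0 Az0 <-].
  rewrite leeNl -EFinN; apply/lee_addgt0Pr => d d0.
  rewrite -leeBlDr// -EFinB; apply: le_limf_einf.
  have dpos : 0 < d / 3 by rewrite divr_gt0.
  (* It suffices to bound the measure of this open neighbourhood of z0 in A. The three thirds of d
     pay for the variation of I on it, the distance from [f eps] to I, and [eps * ln V]. *)
  pose A' := A `&` I @^-1` `]-oo, I z0 + d / 3[%classic.
  have oA' : open A'.
    apply: openI => //; move/continuousP: cI; apply; exact: interval_open.
  have A'0 : A' !=set0.
    by exists z0; split => //=; rewrite in_itv/= ltrDl.
  have [V V0 muV] := laplace_lower_open oA' A'0.
  near=> eps.
  have eps0 : 0 < eps by [].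
  have fI : forall z, `|f eps z - I z| <= d / 3 by near: eps; exact: (close _ dpos).
  have lnV : `|eps * ln V| <= d / 3 by near: eps; exact: near_eps_mul_small.
  have mule : ((expR (- ((I z0 + d / 3 + d / 3) / eps)) * V)%:E <= mu eps A)%E.
    apply: muV => // [z []//|z [_ /=]].
    rewrite in_itv/= => Iz.
    by have /ler_normlP[? ?] := fI z; rewrite -/(f eps z); lra.
  apply: (@le_trans _ _
      (eps%:E * lne (expR (- ((I z0 + d / 3 + d / 3) / eps)) * V)%:E)%E).
    rewrite lne_EFin; last by rewrite mulr_gt0 ?expR_gt0.
    rewrite -EFinM eps_ln_expRM// lee_fin.
    by have /ler_normlP[? ?] := lnV; rewrite -/(I z0); lra.
  apply: lee_wpmul2l; first by rewrite lee_fin ltW.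
  rewrite lee_lne//; rewrite in_itv/= leey andbT.
    by rewrite lee_fin mulr_ge0 ?expR_ge0// ltW.
  by apply: integral_ge0 => z _; rewrite lee_fin expR_ge0.
Unshelve. all: by end_near. Qed.
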